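(* Let $k\ge 2$ be an integer. For any positive integer $m$ and any sequence of integers $\vec b=(b_0,b_1,b_2,\dots)$, the sequence $C^{\vec b}_{k,1},C^{\vec b}_{k,2},\dots$ of $k$-dimensional weighted Catalan numbers is eventually periodic modulo $m$ if there exists a positive integer $s$ such that $m\mid b_{s-j}\,b_{s+k-j'}$ for all $j\in\{0,1,2,\dots,k-1\}$ and all $j'\in\{j,j+1,\dots,k-1\}$.
   Context: A $k$-dimensional Balanced ballot path of $kn$ steps is a lattice path in $\mathbb{Z}^k$ from $(0,\dots,0)$ to $(n,\dots,n)$ with $kn$ steps, each step being one of the standard unit vectors $\vec e_1,\dots,\vec e_k$, such that every point $x=(x_1,\dots,x_k)$ on the path satisfies $x_1\ge x_2\ge\cdots\ge x_k$. An up-step is a step $\vec e_1$. The height of a point $x\in\mathbb{Z}^k$ is $h_k(x)=(k-1)x_1-\sum_{i=2}^k x_i$. The weight of such a path $P$ with respect to $\vec b$ is $wt_{\vec b}(P)=b_{h_1}b_{h_2}\cdots b_{h_n}$, where $h_i$ is the height of the starting point of the $i$-th up-step of $P$. The $n$-th $k$-dimensional weighted Catalan number is $C^{\vec b}_{k,n}=\sum_P wt_{\vec b}(P)$, the sum over all $k$-dimensional Balanced ballot paths $P$ of $kn$ steps. A sequence $(a_n)$ of integers is eventually periodic modulo $m$ if there exist positive integers $N$ and $t$ such that $a_{n+t}\equiv a_n\pmod m$ for all $n\ge N$. *)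

(* Defs.v *)
From mathcomp Require Import all_boot all_order all_algebra.

Set Implicit Arguments.
Unset Strict Implicit.
Unset Printing Implicit Defensive.

Import Order.TTheory GRing.Theory Num.Theory.
Local Open Scope ring_scope.

(* The coordinates x_1, ..., x_k are indexed by 0, ..., k-1 : 'I_k.  A path is
   encoded by its sequence of steps, the step e_(i+1) being recorded as i. *)

Definition path_point (k : nat) (P : seq 'I_k) (t : nat) : 'rV[int]_k :=
  \sum_(i <- take t P) delta_mx 0 i.

Definition ballot_point (k : nat) (x : 'rV[int]_k) : bool :=
  [forall i : 'I_k, forall j : 'I_k, (i <= j)%N ==> (x 0 j <= x 0 i)].

Definition is_balanced_ballot (k n : nat) (P : (k * n).-tuple 'I_k) : bool :=
  (path_point P (k * n) == const_mx n%:Z) &&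
  [forall t : 'I_(k * n).+1, ballot_point (path_point P t)].

Definition is_up_step (k : nat) (i : 'I_k) : bool := val i == 0%N.

(* For k > 0 the first sum has the single term x_1; writing it as a sum avoids
   requiring k to be syntactically a successor. *)
Definition height (k : nat) (x : 'rV[int]_k) : int :=
  (k%:Z - 1) * (\sum_(i < k | val i == 0%N) x 0 i)
  - \sum_(i < k | val i != 0%N) x 0 i.

(* The sequence b_0, b_1, ... is extended by b_i = 0 for i < 0.  Points of a
   ballot path have nonnegative height (height_ge0), so the extension never
   affects the weight of a path. *)
Definition bext (b : nat -> int) (i : int) : int :=
  if i is Posz n then b n else 0.

Definition path_weight (b : nat -> int) (k n : nat)
    (P : (k * n).-tuple 'I_k) : int :=
  \prod_(t < k * n | is_up_step (tnth P t)) bext b (height (path_point P t)).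

Definition weighted_catalan (b : nat -> int) (k n : nat) : int :=
  \sum_(P : (k * n).-tuple 'I_k | is_balanced_ballot P) path_weight b P.

Definition eventually_periodic_mod (m : nat) (a : nat -> int) : Prop :=
  exists N t : nat,
    [/\ (0 < N)%N, (0 < t)%N &
        forall n : nat, (N <= n)%N -> (a (n + t)%N = a n %[mod m])%Z].

Lemma height_ge0 (k : nat) (x : 'rV[int]_k) : ballot_point x -> 0 <= height x.
Proof.
case: k x => [|k] x xP; first by rewrite /height !big_ord0 mulr0 subrr.
rewrite /height big_mkcond [X in _ - X]big_mkcond /= !big_ord_recl /=.
rewrite [X in x 0 ord0 + X]big1 // addr0 add0r (intS k) addrAC subrr add0r subr_ge0.
rewrite -natz mulr_natl -[X in _ *+ X](card_ord k) -sumr_const; apply: ler_sum => i _.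
by have /forallP/(_ ord0)/forallP/(_ (lift ord0 i))/implyP := xP; apply.
Qed.

(* Main.v *)
Require Import Defs.
From mathcomp Require Import all_boot all_order all_algebra.
From mathcomp Require Import zify ring.

Set Implicit Arguments.
Unset Strict Implicit.
Unset Printing Implicit Defensive.

Import Order.TTheory GRing.Theory Num.Theory.
Local Open Scope ring_scope.

(** The divisibility hypothesis says that m divides b_h b_h' as soon as
    h <= s < h' <= h + k - 1.  Consider a path with an up-step starting above
    height s.  Since the path starts at height 0 < s, that up-step has a
    predecessor, and the first up-step starting above s follows an up-step
    from some h <= s; it starts at a height h' <= h + k - 1, because up-steps
    raise the height by k - 1 and all other steps lower it by 1.  So the weight
    of the path is divisible by m.  Hence, modulo m, the weights b_h with h > s
    may be replaced by 0 ([dvdz_walk_sum_truncate]).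

    The weighted Catalan number is the total weight of the ballot walks of kn
    steps from the origin to the diagonal ([weighted_catalan_walk_sum]); such sums
    satisfy a one-step recursion in the number of steps, and they only depend
    on the starting point up to translation along the diagonal, that is, on the
    gaps x_1 - x_i.  For truncated weights, a walk that starts with all gaps at
    most s + 1 keeps them at most s + 1 as long as its weight is nonzero: an
    up-step, which increases the gaps by 1, is only allowed from height at most
    s, and each gap of a ballot point is bounded by its height.  So the residues
    modulo m of the walk sums from the finitely many such starting points, for
    N + 1 steps, are a function of those for N steps
    ([walk_sum_deterministic]).  A sequence in a finite set in which each term
    determines the next is eventually periodic
    ([eventually_periodic_deterministic]). *)

(** * Heights *)

(** In this form the height is visibly invariant under translation along the
    diagonal, and it bounds each gap of a ballot point. *)
Lemma height_sum_gaps (k : nat) (x : 'rV[int]_k.+1) :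
  height x = \sum_i (x 0 ord0 - x 0 i).
Proof.
rewrite /height big_mkcond [X in _ - X]big_mkcond /= !big_ord_recl /=.
rewrite [X in _ * (_ + X)]big1 // addr0 !add0r subrr add0r sumrB.
by rewrite sumr_const card_ord (intS k) addrAC subrr add0r -natz mulr_natl.
Qed.

Lemma height0 (k : nat) : height (0 : 'rV[int]_k.+1) = 0.
Proof. by rewrite height_sum_gaps big1 // => i _; rewrite !mxE subrr. Qed.

Lemma height_step (k : nat) (x : 'rV[int]_k.+1) (i : 'I_k.+1) :
  height (x + delta_mx 0 i) = height x + (if i == ord0 then k%:Z else -1).
Proof.
have -> : height (x + delta_mx 0 i)
    = height x + \sum_j ((ord0 == i)%:Z - (j == i)%:Z).
  rewrite !height_sum_gaps -big_split; apply: eq_bigr => j _ /=.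
  rewrite !mxE /=; ring.
congr (_ + _); rewrite sumrB sumr_const card_ord.
rewrite [X in _ - X](bigD1 i) //= eqxx big1 ?addr0 => [|j /negPf-> //].
rewrite eq_sym; case: eqP => _ /=; last by rewrite mul0rn.
by rewrite mulrS addrAC subrr add0r natz.
Qed.

Lemma ballot_gap_ge0 (k : nat) (x : 'rV[int]_k.+1) (i : 'I_k.+1) :
  ballot_point x -> 0 <= x 0 ord0 - x 0 i.
Proof. by move/forallP/(_ ord0)/forallP/(_ i); rewrite subr_ge0. Qed.

Lemma ballot_gap_le_height (k : nat) (x : 'rV[int]_k.+1) (i : 'I_k.+1) :
  ballot_point x -> x 0 ord0 - x 0 i <= height x.
Proof.
move=> xP; rewrite height_sum_gaps (bigD1 i) //= lerDl.
by apply: sumr_ge0 => j _; apply: ballot_gap_ge0.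
Qed.

(** * Weighted sums over ballot walks *)

Definition diagonal_point (k : nat) (x : 'rV[int]_k) : bool :=
  [forall i, forall j, x 0 i == x 0 j].

(** Walks may start at any x, so that summing over the first step gives a
    recursion, and they may end anywhere on the diagonal, so that the sum is
    invariant under translation along it.  For given x and N the end point is
    nevertheless determined, by its coordinate sum. *)
Fixpoint walk_sum (k : nat) (w : int -> int) (N : nat) (x : 'rV[int]_k) : int :=
  if ballot_point x then
    if N is N'.+1 then
      \sum_(i < k) (if is_up_step i then w (height x) else 1)
                     * walk_sum w N' (x + delta_mx 0 i)
    else (diagonal_point x)%:Z
  else 0.

Lemma walk_sum_nonballot (k : nat) (w : int -> int) (N : nat) (x : 'rV[int]_k) :
  ~~ ballot_point x -> walk_sum w N x = 0.
Proof. by case: N => [|N] /= /negPf->. Qed.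

Lemma walk_sum_translate (k : nat) (w : int -> int) (N : nat) (a : int)
    (x : 'rV[int]_k.+1) :
  walk_sum w N (x + const_mx a) = walk_sum w N x.
Proof.
have ballotD y : ballot_point (y + const_mx a : 'rV_k.+1) = ballot_point y.
  apply: eq_forallb => i; apply: eq_forallb => j.
  by rewrite !mxE lerD2r.
elim: N x => [|N IHN] x /=; rewrite ballotD; case: ifP => // _.
  congr (Posz (nat_of_bool _)).
  apply: eq_forallb => i; apply: eq_forallb => j.
  by rewrite !mxE (inj_eq (addIr a)).
apply: eq_bigr => i _; rewrite addrAC IHN; congr (_ * _).
rewrite !height_sum_gaps; under eq_bigr do rewrite !mxE.
by case: ifP => // _; congr w; apply: eq_bigr => j _; ring.
Qed.

Lemma path_point0 (k : nat) (P : seq 'I_k) : path_point P 0 = 0.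
Proof. by rewrite /path_point take0 big_nil. Qed.

Lemma path_point_cons (k : nat) (i : 'I_k) (P : seq 'I_k) (t : nat) :
  path_point (i :: P) t.+1 = delta_mx 0 i + path_point P t.
Proof. by rewrite /path_point /= big_cons. Qed.

Lemma walk_sumE (k : nat) (w : int -> int) (N : nat) (x : 'rV[int]_k) :
  walk_sum w N x =
  \sum_(P : N.-tuple 'I_k |
        diagonal_point (x + path_point P N)
        && [forall t : 'I_N.+1, ballot_point (x + path_point P t)])
    \prod_(t < N | is_up_step (tnth P t)) w (height (x + path_point P t)).
Proof.
elim: N x => [|N IHN] x /=.
  rewrite big_mkcond (big_pred1 [tuple]) => [|P]; last exact/esym/eqP/tuple0.
  rewrite big_ord0 path_point0 addr0.
  have -> : [forall t : 'I_1, ballot_point (x + path_point [tuple] t)]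
            = ballot_point x.
    apply/forallP/idP => [/(_ ord0)|xP t]; first by rewrite path_point0 addr0.
    by rewrite ord1 path_point0 addr0.
  by case: (ballot_point x); case: diagonal_point.
rewrite [RHS]big_mkcond.
set F := (X in _ = bigop _ _ (fun P => BigBody P _ _ (X P))).
rewrite (reindex (fun p : 'I_k * N.-tuple 'I_k => [tuple of p.1 :: p.2])) /=;
  last first.
  exists (fun P : N.+1.-tuple 'I_k => (thead P, [tuple of behead P])).
    by case=> i P _ /=; congr pair; apply: val_inj.
  by move=> P _ /=; rewrite -tuple_eta.
rewrite -(pair_bigA _ (fun i (P : N.-tuple 'I_k) => F [tuple of i :: P])) /=.
have split_forall i (P : N.-tuple 'I_k) :
    [forall t : 'I_N.+2, ballot_point (x + path_point (i :: P) t)]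
    = ballot_point x
      && [forall t : 'I_N.+1,
            ballot_point (x + delta_mx 0 i + path_point P t)].
  apply/forallP/andP => [H|[xP /forallP H] t].
    split; first by have := H ord0; rewrite path_point0 addr0.
    apply/forallP => t; have := H (lift ord0 t).
    by rewrite /= path_point_cons addrA.
  case: (unliftP ord0 t) => [u|] ->; last by rewrite path_point0 addr0.
  by rewrite /= path_point_cons addrA.
case: ifP => xP; last first.
  rewrite big1 // => i _; rewrite big1 // => P _.
  by rewrite /F split_forall xP andbF.
apply: eq_bigr => i _; rewrite IHN big_distrr big_mkcond /=.
apply: eq_bigr => P _; rewrite /F split_forall xP /= path_point_cons addrA.
case: ifP => // _; rewrite [RHS]big_mkcond big_ord_recl /= path_point0 addr0.
congr (_ * _); rewrite big_mkcond; apply: eq_bigr => t _.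
by rewrite tnthS /= path_point_cons addrA.
Qed.

Lemma coord_sum_path_point (k : nat) (P : seq 'I_k) :
  \sum_j path_point P (size P) 0 j = (size P)%:Z.
Proof.
elim: P => [|i P IHP].
  by rewrite path_point0 big1 // => j _; rewrite mxE.
rewrite /= path_point_cons; under eq_bigr do rewrite mxE.
rewrite big_split /= IHP intS; congr (_ + _).
rewrite (bigD1 i) //= mxE !eqxx big1 ?addr0 // => j /negPf ji.
by rewrite mxE ji.
Qed.

Lemma weighted_catalan_walk_sum (b : nat -> int) (k n : nat) :
  weighted_catalan b k.+1 n = walk_sum (bext b) (k.+1 * n) (0 : 'rV_k.+1).
Proof.
rewrite walk_sumE; apply: eq_big => [P|P _]; last first.
  by apply: eq_bigr => t _; rewrite add0r.
rewrite /is_balanced_ballot add0r; congr (_ && _); last first.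
  by apply: eq_forallb => t; rewrite add0r.
apply/eqP/forallP => [->|H].
  by move=> i; apply/forallP => j; rewrite !mxE.
apply/rowP => j; rewrite mxE.
have := coord_sum_path_point P; rewrite size_tuple.
under eq_bigr do rewrite (eqP (forallP (H _) j)).
rewrite sumr_const card_ord -mulr_natl natz PoszM.
by move/mulfI; apply.
Qed.

(** * Truncating the weights *)

Definition truncate (s : nat) (w : int -> int) (h : int) : int :=
  if h <= s%:Z then w h else 0.

(** The factor c stands for the weight collected before the walk reaches x.  The
    condition on c says that an up-step starting above s makes the weight
    divisible by m if it comes before any further up-step; it survives
    non-up-steps, which lower the height, and is renewed by the divisibility of
    w h * w h' at each up-step from a height h <= s.  At the origin it is
    vacuous, with c = 1. *)
Lemma dvdz_walk_sum_truncate (k m s : nat) (w : int -> int) :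
  (forall h h' : int, h <= s%:Z -> s%:Z < h' -> h' <= h + k%:Z ->
     (m %| w h * w h')%Z) ->
  forall (N : nat) (c : int) (x : 'rV[int]_k.+1),
  (forall h : int, s%:Z < h -> h <= height x -> (m %| c * w h)%Z) ->
  (m %| c * (walk_sum w N x - walk_sum (truncate s w) N x))%Z.
Proof.
move=> dvd_ww; elim=> [|N IHN] c x dvd_c /=; case: ifP => _;
  rewrite ?subrr ?mulr0 ?dvdz0 //.
rewrite -sumrB mulr_sumr; apply: rpred_sum => i _.
set y := x + delta_mx 0 i.
have -> : is_up_step i = (i == ord0) by [].
have := height_step x i; rewrite -/y.
case: eqP => _ hy; last first.
  rewrite !mul1r; apply: IHN => h sh hhy; apply: dvd_c => //; lia.
rewrite /truncate; case: lerP => hx.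
  rewrite -mulrBr mulrA; apply: IHN => h sh hhy.
  by rewrite -mulrA dvdz_mull // dvd_ww // -hy.
by rewrite mul0r subr0 mulrA dvdz_mulr // dvd_c.
Qed.

(** * Finitely many starting points *)

(** When q is 0 at the first index, the values of q are the gaps of this point,
    whose first coordinate is then 0.  So the ballot points with gaps below B
    are translates along the diagonal of finitely many of these points. *)
Definition gap_point (k B : nat) (q : {ffun 'I_k -> 'I_B}) : 'rV[int]_k :=
  \row_i - (q i)%:Z.

Lemma gap_pointP (k s : nat) (x : 'rV[int]_k.+1) :
  (forall i, 0 <= x 0 ord0 - x 0 i <= s.+1%:Z) ->
  exists q : {ffun 'I_k.+1 -> 'I_s.+2}, x = gap_point q + const_mx (x 0 ord0).
Proof.
move=> gaps; exists [ffun i => inord `|(x 0 ord0 - x 0 i)%R|%N].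
apply/rowP => i; rewrite !mxE ffunE inordK; have := gaps i; lia.
Qed.

(** From a ballot point with gaps at most s + 1, a step of nonzero weight leads
    to a point with gaps at most s + 1: a non-up-step increases no gap, and an
    up-step, which increases the gaps by 1, must start at height at most s, so
    from gaps at most s.  Hence the walk sums that enter the recursion are, up
    to translation, among those assumed congruent. *)
Lemma walk_sum_deterministic (k m s : nat) (w : int -> int) (M N : nat) :
  (forall h, s%:Z < h -> w h = 0) ->
  (forall q : {ffun 'I_k.+1 -> 'I_s.+2},
     (walk_sum w M (gap_point q) = walk_sum w N (gap_point q) %[mod m])%Z) ->
  forall q : {ffun 'I_k.+1 -> 'I_s.+2},
    (walk_sum w M.+1 (gap_point q) = walk_sum w N.+1 (gap_point q) %[mod m])%Z.
Proof.
move=> w0 eqMN q.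
have eqMN_gaps (x : 'rV[int]_k.+1) : (forall i, x 0 ord0 - x 0 i <= s.+1%:Z) ->
    (m %| walk_sum w M x - walk_sum w N x)%Z.
  move=> gaps; case: (boolP (ballot_point x)) => [xP|xN]; last first.
    by rewrite !walk_sum_nonballot ?subrr ?dvdz0.
  have /gap_pointP[p ->] : forall i, 0 <= x 0 ord0 - x 0 i <= s.+1%:Z.
    by move=> i; rewrite ballot_gap_ge0 ?gaps.
  by rewrite !walk_sum_translate -eqz_mod_dvd; apply/eqP.
set y := gap_point q.
have gaps i : y 0 ord0 - y 0 i <= s.+1%:Z.
  by rewrite !mxE; have := ltn_ord (q i); lia.
apply/eqP; rewrite eqz_mod_dvd /=; case: ifP => yP; last by rewrite subrr.
rewrite -sumrB; apply: rpred_sum => i _; rewrite -mulrBr.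
have -> : is_up_step i = (i == ord0) by [].
case: eqP => [->|/eqP i0].
  case: (lerP (height y) s%:Z) => [hy|/w0->]; last by rewrite mul0r dvdz0.
  apply/dvdz_mull/eqMN_gaps => j; rewrite !mxE /=.
  have := ballot_gap_le_height j yP; rewrite !mxE; lia.
rewrite mul1r; apply: eqMN_gaps => j; have := gaps j.
by rewrite !mxE /= eq_sym (negPf i0); lia.
Qed.

(** * Periodicity *)

(** Pigeonhole on the tuples of residues (u N q mod m)_q gives a coincidence
    between two indices, which the hypothesis propagates to all later ones. *)
Lemma eventually_periodic_deterministic (m : nat) (Q : finType)
    (u : nat -> Q -> int) :
  (0 < m)%N ->
  (forall M N : nat, (forall q, (u M q = u N q %[mod m])%Z) ->
     forall q, (u M.+1 q = u N.+1 q %[mod m])%Z) ->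
  exists N t : nat, (0 < t)%N /\
    forall n, (N <= n)%N -> forall q, (u (n + t)%N q = u n q %[mod m])%Z.
Proof.
case: m => // m _ det.
pose f (N : 'I_#|{ffun Q -> 'I_m.+1}|.+1) : {ffun Q -> 'I_m.+1} :=
  [ffun q => inord `|(u N q %% m.+1%:Z)%Z|%N].
have /injectivePn[i [j ij eqf]] : ~~ injectiveb f.
  by apply/negP => /injectiveP/leq_card; rewrite card_ord ltnn.
have {}eqf q : (u i q = u j q %[mod m.+1])%Z.
  have := congr1 (fun g : {ffun Q -> 'I_m.+1} => val (g q)) eqf.
  by rewrite /f /= !ffunE !inordK; lia.
wlog lt_ij : i j ij eqf / (i < j)%N => [wlog_ij|].
  case: (ltngtP i j) => [lt_ij|lt_ji|/val_inj eq_ij].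
  - exact: (wlog_ij i j).
  - by apply: (wlog_ij j i); rewrite // eq_sym.
  - by rewrite eq_ij eqxx in ij.
exists (val i), (j - i)%N; split; first by rewrite subn_gt0.
move=> n /subnK <-; elim: (n - i)%N => [|d IHd] q.
  by rewrite add0n subnKC // ltnW.
by rewrite !addSn; apply: det.
Qed.

Theorem theorem3p6 (k : nat) (hk : (2 <= k)%N) (m : nat) (hm : (0 < m)%N)
    (b : nat -> int)
    (hs : exists s : nat, (0 < s)%N /\
      forall j j' : nat, (j <= k - 1)%N -> (j <= j' <= k - 1)%N ->
        (m %| bext b (s%:Z - j%:Z) * bext b (s%:Z + k%:Z - j'%:Z))%Z) :
  eventually_periodic_mod m (fun n : nat => weighted_catalan b k n).
Proof.
case: k hk hs => // k _ [s [s_gt0 dvd_bb]].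
set w := truncate s (bext b).
have catalanE n : (weighted_catalan b k.+1 n
    = walk_sum w (k.+1 * n) (0 : 'rV_k.+1) %[mod m])%Z.
  apply/eqP; rewrite eqz_mod_dvd weighted_catalan_walk_sum -[X in (_ %| X)%Z]mul1r.
  apply: dvdz_walk_sum_truncate => [h h' hs sh' h'h|h sh]; last first.
    by rewrite height0; lia.
  (* j = s - h and j' = s + k.+1 - h'; j < j' because h' <= h + k. *)
  have := dvd_bb `|(s%:Z - h)%R|%N `|(s%:Z + k.+1%:Z - h')%R|%N.
  have -> : s%:Z - `|(s%:Z - h)%R|%N%:Z = h by lia.
  have -> : s%:Z + k.+1%:Z - `|(s%:Z + k.+1%:Z - h')%R|%N%:Z = h' by lia.
  by apply; lia.
have w0 h : s%:Z < h -> w h = 0 by rewrite /w /truncate; case: lerP.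
have [N [t [t_gt0 per]]] := eventually_periodic_deterministic hm
  (fun M N => @walk_sum_deterministic k m s w M N w0).
(* The gaps of the origin are 0, so it is one of the finitely many starts. *)
have [//|q q0] := @gap_pointP k s 0; first by move=> i; rewrite !mxE.
rewrite mxE addr0 in q0.
(* [per] counts single steps; increasing n by t adds k.+1 * t steps. *)
have per_mul d M : (N <= M)%N ->
    (walk_sum w (M + d * t) (gap_point q) = walk_sum w M (gap_point q)
       %[mod m])%Z.
  elim: d M => [|d IHd] M NM; first by rewrite mul0n addn0.
  by rewrite mulSn addnA IHd ?per // (leq_trans NM) // leq_addr.
exists N.+1, t; split=> // n Nn; rewrite !catalanE q0 mulnDr.
by apply: per_mul; lia.
Qed.
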